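(* Let $(\rho_h,m_h)$ be a solution on $[0,T]$ of the semi-discrete problem (S) defined in the context. Then, for all $t\in[0,T]$, $$\frac{d}{dt}\int_{\mathcal E}\rho_h\,dx=0$$ and $$\frac{d}{dt}\int_{\mathcal E}\Big(\frac{m_h^2}{2\rho_h}+P(\rho_h)\Big)dx+\int_{\mathcal E}\Big(\frac{a}{\rho_h^2}|\partial_x'm_h|^2+b\frac{|m_h|^3}{\rho_h^2}\Big)dx=0.$$
   Context: Network. $\mathcal G=(\mathcal V,\mathcal E,\ell)$ is a finite, directed, connected graph with vertex set $\mathcal V$, edge set $\mathcal E\subset\mathcal V\times\mathcal V$, and lengths $\ell_e>0$, $e\in\mathcal E$. An edge $e=(v_1,v_2)$ is identified with the interval $[0,\ell_e]$ ($v_1$ corresponding to $0$, $v_2$ to $\ell_e$), and $n_e(v_1)=-1$, $n_e(v_2)=1$. $\mathcal E(v)$ is the set of edges incident on $v$. For a function $u$ on the network, $u_e=u|_e$, and $u_e(v)$ is its value at the endpoint $v$. $L^2(\mathcal E)$ and $H^1(\mathcal E)$ are the spaces of functions with $u_e\in L^2(e)$, resp. $H^1(e)$, for every $e$ (no continuity at vertices); $(u,v)_{\mathcal E}=\sum_{e}\int_0^{\ell_e}u_ev_e\,dx$, $\int_{\mathcal E}u\,dx=\sum_e\int_0^{\ell_e}u_e\,dx$; $(\partial_x'u)|_e=\partial_x(u_e)$. $H_0(\mathrm{div})=\{m\in H^1(\mathcal E):\sum_{e\in\mathcal E(v)}m_e(v)n_e(v)=0\ \forall v\in\mathcal V\}$.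 Data. $a_e,b_e\ge0$, $c_e>0$ are constants on each edge, $a,b$ the edgewise constant functions with values $a_e,b_e$; $\gamma>1$; $P_e(\rho)=\frac{c_e}{\gamma-1}\rho^\gamma$; $P(\rho),P'(\rho)$ have restrictions $P_e(\rho_e),P_e'(\rho_e)$ to $e$. Finite element spaces. $T_h(e)$ is a uniform mesh of $[0,\ell_e]$ into finitely many subintervals $K$, and $T_h(\mathcal E)$ is the collection of these meshes. $P_k(T_h(\mathcal E))$ is the space of functions in $L^2(\mathcal E)$ that are polynomials of degree $\le k$ on every element $K$. $V_h=P_1(T_h(\mathcal E))\cap H_0(\mathrm{div})$ and $Q_h=P_0(T_h(\mathcal E))$. Semi-discrete problem (S): given $\rho_{0,h}\in Q_h$ with $\rho_{0,h}>0$ and $m_{0,h}\in V_h$, find $(\rho_h,m_h)\in C^1([0,T];Q_h\times V_h)$ with $\rho_h>0$, $\rho_h(0)=\rho_{0,h}$, $m_h(0)=m_{0,h}$, such that for all $q_h\in Q_h$, $v_h\in V_h$ and every $t\in[0,T]$ \begin{align*} (\partial_t\rho_h,q_h)_{\mathcal E}&=-(\partial_x'm_h,q_h)_{\mathcal E},\\ \Big(\tfrac1{\rho_h}\partial_tm_h-\tfrac{m_h}{2\rho_h^2}\partial_t\rho_h,v_h\Big)_{\mathcal E}&=\Big(\tfrac{m_h^2}{2\rho_h^2}+P'(\rho_h)-\tfrac{a}{\rho_h^2}\partial_x'm_h,\partial_x'v_h\Big)_{\mathcal E}-\Big(\tfrac{m_h}{2\rho_h^2}\partial_x'm_h+b\tfrac{|m_h|m_h}{\rho_h^2},v_h\Big)_{\mathcal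 E}. \end{align*} *)

(* Defs.v *)
From mathcomp Require Export all_boot all_order all_algebra.
From mathcomp Require Export all_classical all_reals all_analysis.
Export Order.TTheory GRing.Theory Num.Theory.
Export numFieldNormedType.Exports.

Set Implicit Arguments.
Unset Strict Implicit.
Unset Printing Implicit Defensive.

Local Open Scope classical_set_scope.
Local Open Scope ring_scope.

(** * Networks *)

(* Connectedness is that of the underlying undirected graph.  Since edges are
   pairs of vertices there is at most one edge from one vertex to another;
   self-loops are not excluded. *)
Record network (R : realType) := Network {
  vertex : finType;
  edges : {set vertex * vertex};
  len : {e : vertex * vertex | e \in edges} -> R;
  len_gt0 : forall e, 0 < len e;
  vertex_gt0 : (0 < #|vertex|)%N;
  network_connected : forall v w : vertex,
    connect (fun x y => ((x, y) \in edges) || ((y, x) \in edges)) v w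
}.

Definition edge (R : realType) (G : network R) : Type :=
  {e : vertex G * vertex G | e \in edges G}.

Section Network.
Context {R : realType} (G : network R).

Definition edge_tail (e : edge G) : vertex G := (val e).1.
Definition edge_head (e : edge G) : vertex G := (val e).2.

(* u e x is the value of u at the point x of [0, len e]; the values of u e
   outside of this interval play no role.  Elements of L^2 are handled through
   representatives. *)
Definition netfun : Type := edge G -> R -> R.

Definition edge_set (e : edge G) : set R := `[0, len e].

Definition net_int (u : netfun) : R :=
  \sum_(e : edge G) \int[lebesgue_measure]_(x in edge_set e) u e x.

Definition net_ip (u v : netfun) : R := net_int (fun e x => u e x * v e x).

Definition net_norm (u : netfun) : R := Num.sqrt (net_ip u u).

Definition net_ae (P : edge G -> R -> Prop) : Prop :=
  forall e, {ae lebesgue_measure, forall x, edge_set e x -> P e x}.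

(** * Function spaces *)

Definition L2_on (l : R) (f : R -> R) : Prop :=
  measurable_fun `[0, l] f /\
  lebesgue_measure.-integrable `[0, l] (fun x => (f x ^+ 2)%:E).

Definition test_function (l : R) (phi : R -> R) : Prop :=
  (forall n x, derivable (derive1n n phi) x 1) /\
  exists a b, [/\ 0 < a, b < l & forall x, x \notin `[a, b] -> phi x = 0].

Definition weak_derivative (l : R) (f g : R -> R) : Prop :=
  forall phi, test_function l phi ->
    \int[lebesgue_measure]_(x in `[0, l]) (f x * derive1 phi x) =
    - \int[lebesgue_measure]_(x in `[0, l]) (g x * phi x).

(* H^1(0, l), every class being represented by its continuous representative,
   so that the endpoint values f 0 and f l are the traces of f. *)
Definition H1_on (l : R) (f : R -> R) : Prop :=
  [/\ L2_on l f, {within `[0, l], continuous f} &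
      exists2 g, L2_on l g & weak_derivative l f g].

Definition L2 (u : netfun) : Prop := forall e, L2_on (len e) (u e).

Definition H1 (u : netfun) : Prop := forall e, H1_on (len e) (u e).

(* A function in H^1 is almost everywhere differentiable in the classical sense
   and its classical derivative is its weak derivative. *)
Definition dx (u : netfun) : netfun := fun e => derive1 (u e).

(* The outer normal n_e is 1 at the head of e and -1 at its tail, whence the
   two sums over the edges incident on v; a self-loop contributes to both. *)
Definition H0div (u : netfun) : Prop :=
  H1 u /\
  forall v : vertex G,
    \sum_(e : edge G | edge_head e == v) u e (len e)
    - \sum_(e : edge G | edge_tail e == v) u e 0 = 0.

(** * Finite elements *)

Definition mesh_node (N : edge G -> nat) (e : edge G) (i : nat) : R :=
  len e * i%:R / (N e)%:R.

(* N e is the number of elements of the uniform mesh of the edge e.  Polynomial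
   behaviour is required on open elements: the values at the mesh nodes of a
   discontinuous piecewise polynomial function are irrelevant in L^2. *)
Definition Pk (N : edge G -> nat) (k : nat) (u : netfun) : Prop :=
  L2 u /\
  forall (e : edge G) (i : 'I_(N e)), exists2 p : {poly R},
    (size p <= k.+1)%N &
    forall x, x \in `]mesh_node N e i, mesh_node N e i.+1[ -> u e x = p.[x].

Definition Vh (N : edge G -> nat) (u : netfun) : Prop := Pk N 1 u /\ H0div u.

Definition Qh (N : edge G -> nat) (u : netfun) : Prop := Pk N 0 u.

(** * Time derivatives on [0, T], one-sided at the end points *)

Definition has_time_derivative (T : R) (f : R -> R) (t d : R) : Prop :=
  (s - t)^-1 * (f s - f t) @[s --> within `[0, T] t^'] --> d.

(* u belongs to C^1([0, T]; X) with derivative du, where X is normed by the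
   norm of L^2. *)
Definition C1_in (T : R) (X : netfun -> Prop) (u du : R -> netfun) : Prop :=
  forall t, t \in `[0, T] ->
  [/\ X (u t), X (du t),
      net_norm (fun e x => (s - t)^-1 * (u s e x - u t e x) - du t e x)
        @[s --> within `[0, T] t^'] --> 0 &
      net_norm (fun e x => du s e x - du t e x)
        @[s --> within `[0, T] t^'] --> 0].

(** * The semi-discrete problem *)

Definition pot (gam : R) (c : edge G -> R) (e : edge G) (r : R) : R :=
  c e / (gam - 1) * r `^ gam.

Definition dpot (gam : R) (c : edge G -> R) (e : edge G) (r : R) : R :=
  derive1 (pot gam c e) r.

Definition mass_equation (N : edge G -> nat) (drho m : netfun) : Prop :=
  forall q, Qh N q -> net_ip drho q = - net_ip (dx m) q.

Definition momentum_equation (gam : R) (a b c : edge G -> R) (N : edge G -> nat)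
    (rho m drho dm : netfun) : Prop :=
  forall v, Vh N v ->
  net_ip (fun e x => (rho e x)^-1 * dm e x
                     - m e x / (2 * rho e x ^+ 2) * drho e x) v =
  net_ip (fun e x => m e x ^+ 2 / (2 * rho e x ^+ 2)
                     + dpot gam c e (rho e x)
                     - a e / rho e x ^+ 2 * dx m e x) (dx v)
  - net_ip (fun e x => m e x / (2 * rho e x ^+ 2) * dx m e x
                       + b e * (`|m e x| * m e x / rho e x ^+ 2)) v.

Definition semidiscrete_solution (gam : R) (a b c : edge G -> R)
    (N : edge G -> nat) (T : R) (rho0 m0 : netfun) (rho m : R -> netfun)
    : Prop :=
  exists drho dm : R -> netfun,
  [/\ C1_in T (Qh N) rho drho /\ C1_in T (Vh N) m dm,
      forall t, t \in `[0, T] -> net_ae (fun e x => 0 < rho t e x),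
      net_ae (fun e x => rho 0 e x = rho0 e x) /\
      net_ae (fun e x => m 0 e x = m0 e x) &
      forall t, t \in `[0, T] ->
        mass_equation N (drho t) (m t) /\
        momentum_equation gam a b c N (rho t) (m t) (drho t) (dm t)].

End Network.

(* Main.v *)
Require Import Defs.
From mathcomp Require Import measurable_realfun zify ring lra.

(* On every element the density is constant and the momentum is affine, so the
   energy density is a quadratic polynomial and its integral is a fixed linear
   combination of its values at three interior points of the element.  By the
   inverse inequality, convergence in L^2 of piecewise affine functions implies
   convergence at every interior point of an element; the integrals can
   therefore be differentiated in time pointwise.  Testing the mass equation with
   1 gives the conservation of mass, since the integrals of the derivative of m
   over the edges telescope to the balance of fluxes at the vertices.  Testing
   the momentum equation with m and the mass equation with P'(rho), which belongs
   to Q_h because rho is piecewise constant, gives the energy identity: the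
   terms m^2 / (2 rho^2) * dx m cancel. *)

Set Implicit Arguments.
Unset Strict Implicit.
Unset Printing Implicit Defensive.

Local Open Scope classical_set_scope.
Local Open Scope ring_scope.

(** * Integrals of functions known only on open intervals *)

Lemma integrable_setU_disjoint {d : measure_display} {T : measurableType d}
    {R : realType} {mu : {measure set T -> \bar R}} {A B : set T} {f : T -> \bar R} :
  measurable A -> measurable B -> [disjoint A & B] ->
  mu.-integrable A f -> mu.-integrable B f ->
  mu.-integrable (A `|` B) f.
Proof.
move=> mA mB AB /integrableP[mfA fA] /integrableP[mfB fB].
have mfAB := (measurable_funU _ mA mB).2 (conj mfA mfB).
apply/integrableP; split => //; rewrite ge0_integral_setU//.
  exact: lte_add_pinfty.
exact: measurableT_comp.
Qed.

Section Integration.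
Context {R : realType}.
Implicit Types (f g : R -> R) (a b : R) (x : nat -> R).

Local Notation mu := (@lebesgue_measure R).

Lemma integrable_set1 f a : mu.-integrable [set a] (EFin \o f).
Proof.
apply/integrableP; split; first exact: measurable_fun_set1.
by rewrite integral_set1.
Qed.

(** Every function is integrable on a one-point set, so the uncontrolled values at the mesh nodes do
    no harm. *)
Lemma integrable_oo_cc f a b : a <= b ->
  mu.-integrable `]a, b[ (EFin \o f) -> mu.-integrable `[a, b] (EFin \o f).
Proof.
move=> ab fi; rewrite -(@setUitv1 _ _ _ _ true) ?bnd_simp//.
have [<-|ab'] := eqVneq a b.
  by rewrite set_itvco0// set0U; exact: integrable_set1.
have {}ab : a < b by rewrite lt_neqAle ab'.
rewrite -(@setU1itv _ _ _ _ false) ?bnd_simp//.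
have d1 : [disjoint [set a] & `]a, b[].
  by apply/disj_setPS => z [/= ->]; rewrite in_itv/= ltxx.
have d2 : [disjoint a |` `]a, b[ & [set b]].
  apply/disj_setPS => z [/= [->|]].
    by move=> /eqP; rewrite (negbTE ab').
  by move=> + zb; rewrite zb in_itv/= ltxx andbF.
apply: integrable_setU_disjoint => //; [exact: measurableU| |exact: integrable_set1].
by apply: integrable_setU_disjoint => //; exact: integrable_set1.
Qed.

Lemma integrable_agree_oo f g a b : continuous g -> a <= b ->
  {in `]a, b[, f =1 g} -> mu.-integrable `[a, b] (EFin \o f).
Proof.
move=> cg ab fg; apply: integrable_oo_cc => //.
apply: (@eq_integrable _ (measurableTypeR R) R mu `]a, b[ (measurable_itv _) (EFin \o g)).
  by move=> z; rewrite inE/= => zab; rewrite fg.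
apply: (@integrableS _ (measurableTypeR R) _ _ `[a, b]) => //; first exact: subset_itv_oo_cc.
apply: continuous_compact_integrable; first exact: segment_compact.
by apply: continuous_subspaceT => z; exact: cg.
Qed.

Lemma integrable_chain x n f : (forall i, x i <= x i.+1) ->
  (forall i, (i < n)%N -> mu.-integrable `[x i, x i.+1] (EFin \o f)) ->
  mu.-integrable `[x 0, x n] (EFin \o f) /\
  \int[mu]_(y in `[x 0, x n]) f y =
  \sum_(i < n) \int[mu]_(y in `[x i, x i.+1]) f y.
Proof.
move=> x_le; elim: n => [_|n IHn fi].
  by rewrite big_ord0 set_itv1 Rintegral_set1; split => //; exact: integrable_set1.
have x0n m : x 0%N <= x m by elim: m => // m IHm; exact: le_trans (x_le m).
have [fi0 fE] := IHn (fun i ni => fi i (ltn_trans ni (ltnSn _))).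
(* The new piece is taken left-open to make the union disjoint; its integral is that over the closed
   piece. *)
have fin : mu.-integrable `]x n, x n.+1] (EFin \o f).
  by apply: integrableS (fi n (ltnSn _)) => //; exact: subset_itv_oc_cc.
have UE : (`[x 0%N, x n] `|` `]x n, x n.+1] = `[x 0%N, x n.+1])%classic.
  by rewrite -itv_bndbnd_setU ?bnd_simp//=.
have dsj : [disjoint `[x 0%N, x n] & `]x n, x n.+1]].
  by apply/disj_setPS => z /= []; rewrite !in_itv/=; lra.
have fiU : mu.-integrable (`[x 0, x n] `|` `]x n, x n.+1]) (EFin \o f).
  exact: integrable_setU_disjoint.
split; first by rewrite -UE.
by rewrite -UE Rintegral_setU// fE big_ord_recr/= Rintegral_itv_obnd_cbnd.
Qed.

Lemma eq_Rintegral_oo f g a b : mu.-integrable `[a, b] (EFin \o f) ->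
  mu.-integrable `[a, b] (EFin \o g) -> {in `]a, b[, f =1 g} ->
  \int[mu]_(y in `[a, b]) f y = \int[mu]_(y in `[a, b]) g y.
Proof.
move=> /integrableP[/measurable_EFinP mf _] /integrableP[/measurable_EFinP mg _] fg.
congr fine; apply: eq_integral_itv_bounded => //.
- by apply: measurable_funS mf => //; exact: subset_itv_oo_cc.
- by apply: measurable_funS mg => //; exact: subset_itv_oo_cc.
Qed.

Lemma Rintegral_poly (p q : {poly R}) a b : a < b -> q^`() = p ->
  \int[mu]_(y in `[a, b]) p.[y] = q.[b] - q.[a].
Proof.
move=> ab qp; rewrite /Rintegral (@continuous_FTC2 _ (horner p) (horner q))//.
- by apply: continuous_subspaceT => z; exact: continuous_horner.
- split; [by move=> z _; exact: derivable_horner| |].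
  + by apply: cvg_at_right_filter; exact: continuous_horner.
  + by apply: cvg_at_left_filter; exact: continuous_horner.
- by move=> z _; rewrite -derivE qp.
Qed.

End Integration.

(** * Quadrature and an inverse inequality on one element *)

Section Quadrature.
Context {R : realType}.
Implicit Types (p : {poly R}) (f : R -> R) (a b : R).

Local Notation mu := (@lebesgue_measure R).

Lemma horner_size3 p x : (size p <= 3)%N ->
  p.[x] = p`_0 + p`_1 * x + p`_2 * x ^+ 2.
Proof.
by move=> sp; rewrite (horner_coef_wide _ sp) !big_ord_recr big_ord0/= add0r mulr1.
Qed.

Lemma Rintegral_poly_size3 p a b : (size p <= 3)%N -> a < b ->
  \int[mu]_(y in `[a, b]) p.[y] =
  (b - a) * p`_0 + (b ^+ 2 - a ^+ 2) / 2 * p`_1 + (b ^+ 3 - a ^+ 3) / 3 * p`_2.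
Proof.
move=> sp ab.
rewrite (@Rintegral_poly _ _
  (p`_0 *: 'X + (p`_1 / 2) *: 'X^2 + (p`_2 / 3) *: 'X^3))//.
  by rewrite !hornerD !hornerZ !hornerXn !hornerX; field.
apply/polyP => i; rewrite coef_deriv !coefD !coefZ coefX !coefXn.
case: i => [|[|[|i]]] /=; rewrite ?mulr0 ?mulr1 ?addr0 ?add0r//.
- by field.
- by field.
- by rewrite nth_default ?mul0rn// (leq_trans sp).
Qed.

(* The three-point open Newton-Cotes rule: the values at the end points are not
   used, as they are arbitrary for piecewise polynomial functions. *)
Definition milne f a b : R :=
  (b - a) / 3 * (2 * f ((3 * a + b) / 4) - f ((a + b) / 2)
                 + 2 * f ((a + 3 * b) / 4)).

Lemma Rintegral_milne p f a b : (size p <= 3)%N -> a < b ->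
  {in `]a, b[, forall y, f y = p.[y]} ->
  \int[mu]_(y in `[a, b]) f y = milne f a b.
Proof.
move=> sp ab fp.
have fi : mu.-integrable `[a, b] (EFin \o f).
  by apply: (integrable_agree_oo (g := horner p)) => //;
    [exact: continuous_horner|exact: ltW].
have pi : mu.-integrable `[a, b] (EFin \o horner p).
  by apply: (integrable_agree_oo (g := horner p)) => //;
    [exact: continuous_horner|exact: ltW].
rewrite (eq_Rintegral_oo fi pi fp) Rintegral_poly_size3// /milne.
by rewrite !fp ?in_itv/=; [rewrite !horner_size3//; field|lra..].
Qed.

(** For an affine function with midpoint value g, slope v and h = b - a, the integral of the square
    is h g^2 + v^2 h^3 / 12. The constant 6 exceeds the sharp constant 4 and leaves a remainder that
    is visibly nonnegative. *)
Lemma inverse_inequality p f a b y : (size p <= 2)%N ->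
  {in `]a, b[, forall z, f z = p.[z]} -> y \in `]a, b[ ->
  f y ^+ 2 <= 6 / (b - a) * \int[mu]_(z in `[a, b]) (f z ^+ 2).
Proof.
move=> sp fp yab; have ab : a < b by move: yab; rewrite in_itv/=; lra.
rewrite (@Rintegral_milne (p * p) (fun z => f z ^+ 2))//; last 2 first.
- by rewrite (leq_trans (size_polyMleq _ _))//; move: (size p) sp => [|[|[|]]].
- by move=> z zab; rewrite fp// hornerM.
rewrite /milne !fp ?in_itv//=; [|lra..].
rewrite !horner_size3 ?(leq_trans sp)// (nth_default _ sp)//.
set u := p`_0; set v := p`_1.
move: yab; rewrite in_itv/= => /andP[ay yb].
rewrite -subr_ge0.
(* Here [u + v * ((a + b) / 2)] is the midpoint value; only the last summand uses that y lies
   between a and b. *)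
rewrite [leRHS](_ : _ =
    (u + v * ((a + b) / 2) - v * (y - (a + b) / 2)) ^+ 2
    + 4 * (u + v * ((a + b) / 2)) ^+ 2
    + 2 * v ^+ 2 * ((y - a) * (b - y))); last by field; lra.
apply: addr_ge0; first by apply: addr_ge0; [|apply: mulr_ge0]; rewrite ?sqr_ge0.
by apply: mulr_ge0; apply: mulr_ge0; rewrite ?sqr_ge0 ?subr_ge0 ?ltW.
Qed.

End Quadrature.

(** * Calculus of time derivatives relative to [0, T] *)

Section TimeDerivative.
Context {R : realType} (T t : R).
Implicit Types (f g : R -> R) (d k : R).

Local Notation htd f d := (has_time_derivative T f t d).

Lemma eq_has_time_derivative f g d : t \in `[0, T] ->
  {in `[0, T], f =1 g} -> htd f d -> htd g d.
Proof.
move=> tT fg; apply: cvg_trans; apply: near_eq_cvg.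
near=> s; have sT : s \in `[0, T] by near: s; exact: withinT.
by rewrite !fg.
Unshelve. all: by end_near. Qed.

Lemma has_time_derivative_cvg f d :
  htd f d -> f s @[s --> within `[0, T] t^'] --> f t.
Proof.
move=> fd; have -> : f t = f t + (t - t) * d by rewrite subrr mul0r addr0.
apply: (@cvg_trans _ ((fun s => f t + (s - t) * ((s - t)^-1 * (f s - f t)))
    @ within `[0, T] t^')).
  apply: near_eq_cvg; near=> s.
  (* The filter is punctured at t, so the difference quotient can be multiplied back by s - t. *)
  have st : s != t by near: s; apply: cvg_within; exact: withinT.
  have {}st : s - t != 0 by rewrite subr_eq0.
  by rewrite mulVKf// addrC subrK.
apply: cvgD; first exact: cvg_cst.
apply: cvgM fd; apply: cvgB; last exact: cvg_cst.
by apply: cvg_trans (@nbhs_dnbhs _ t); exact: cvg_within.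
Unshelve. all: by end_near. Qed.

Lemma has_time_derivativeD f g d k :
  htd f d -> htd g k -> htd (fun s => f s + g s) (d + k).
Proof.
move=> fd gd; apply: cvg_trans (cvgD fd gd).
by apply: near_eq_cvg; apply: nearW => s; rewrite !fctE; ring.
Qed.

(** The increment is split as (f s - f t) g s + f t (g s - g t), which needs the continuity of g at
    t. *)
Lemma has_time_derivativeM f g d k : htd f d -> htd g k ->
  htd (fun s => f s * g s) (d * g t + f t * k).
Proof.
move=> fd gd.
have gt := has_time_derivative_cvg gd.
apply: cvg_trans (cvgD (cvgM fd gt) (cvgM (cvg_cst (f t)) gd)).
by apply: near_eq_cvg; apply: nearW => s; rewrite !fctE/=; ring.
Qed.

Lemma has_time_derivative_cst c : htd (fun=> c) 0.
Proof.
rewrite /has_time_derivative subrr; under eq_cvg do rewrite mulr0.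
exact: cvg_cst.
Qed.

Lemma has_time_derivativeZ c f d : htd f d -> htd (fun s => c * f s) (c * d).
Proof.
move=> fd; rewrite -[c * d]add0r -[0](mul0r (f t)).
exact: has_time_derivativeM (has_time_derivative_cst c) fd.
Qed.

Lemma has_time_derivative_sum (I : Type) (r : seq I) (F : I -> R -> R) (D : I -> R) :
  (forall i, htd (F i) (D i)) ->
  htd (fun s => \sum_(i <- r) F i s) (\sum_(i <- r) D i).
Proof.
move=> FD; elim: r => [|i r IHr].
  by under eq_fun do rewrite big_nil; rewrite big_nil; exact: has_time_derivative_cst.
under eq_fun do rewrite big_cons; rewrite big_cons.
exact: has_time_derivativeD.
Qed.

(** Carathéodory's factorization of the increment of [phi] avoids dividing by f s - f t, which may
    vanish. *)
Lemma has_time_derivative_comp (phi : R -> R) f d k :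
  is_derive (f t) (1 : R) phi k -> htd f d -> htd (phi \o f) (k * d).
Proof.
move=> /is_derive1_caratheodory[g [phiE gc <-]] fd.
have gf : g (f s) @[s --> within `[0, T] t^'] --> g (f t).
  exact: cvg_comp (has_time_derivative_cvg fd) gc.
apply: cvg_trans (cvgM gf fd).
by apply: near_eq_cvg; apply: nearW => s; rewrite !fctE/= phiE mulrCA.
Qed.

End TimeDerivative.

(** * Piecewise continuous and piecewise polynomial functions on the mesh *)

Section PiecewisePolynomial.
Context {R : realType} {G : network R} (N : edge G -> nat)
  (N_gt0 : forall e, (0 < N e)%N).
Implicit Types (u v w : netfun G) (e : edge G).

Local Notation mu := (@lebesgue_measure R).
Local Notation node := (mesh_node N).

Lemma mesh_node_lt e i : node e i < node e i.+1.
Proof.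
rewrite /mesh_node ltr_pM2r ?invr_gt0 ?ltr0n// ltr_pM2l ?len_gt0//.
by rewrite ltr_nat.
Qed.

Lemma mesh_node0 e : node e 0 = 0.
Proof. by rewrite /mesh_node mulr0 mul0r. Qed.

Lemma mesh_nodeN e : node e (N e) = len e.
Proof. by rewrite /mesh_node mulfK// pnatr_eq0 -lt0n. Qed.

(** The witness is continuous on the whole line, hence bounded on the closed element; this gives the
    integrability that additivity of the integrals requires. *)
Definition pw_continuous u : Prop := forall e (i : 'I_(N e)),
  exists2 g : R -> R, continuous g & {in `]node e i, node e i.+1[, u e =1 g}.

(* The second component of [Pk N k] is [pw_poly k.+1]. *)
Definition pw_poly k u : Prop := forall e (i : 'I_(N e)),
  exists2 p : {poly R}, (size p <= k)%N &
  forall x, x \in `]node e i, node e i.+1[ -> u e x = p.[x].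

Lemma pw_continuous_integrable u e : pw_continuous u ->
  mu.-integrable `[0, len e] (EFin \o u e) /\
  \int[mu]_(x in `[0, len e]) u e x =
  \sum_(i < N e) \int[mu]_(x in `[node e i, node e i.+1]) u e x.
Proof.
move=> uc; have := @integrable_chain R (node e) (N e) (u e).
rewrite mesh_node0 mesh_nodeN; apply => [i|i iN].
  exact/ltW/mesh_node_lt.
have [g cg ug] := uc e (Ordinal iN).
by apply: integrable_agree_oo ug => //; exact/ltW/mesh_node_lt.
Qed.

Lemma net_int_elements u : pw_continuous u -> net_int u =
  \sum_e \sum_(i < N e) \int[mu]_(x in `[node e i, node e i.+1]) u e x.
Proof.
by move=> uc; apply: eq_bigr => e _; have [_ <-] := pw_continuous_integrable e uc.
Qed.

Lemma net_intD u v : pw_continuous u -> pw_continuous v ->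
  net_int (fun e x => u e x + v e x) = net_int u + net_int v.
Proof.
move=> uc vc; rewrite /net_int -big_split/=; apply: eq_bigr => e _.
have [ui _] := pw_continuous_integrable e uc.
have [vi _] := pw_continuous_integrable e vc.
by rewrite /edge_set RintegralD.
Qed.

Lemma pw_poly_continuous k u : pw_poly k u -> pw_continuous u.
Proof.
move=> uk e i; have [p _ up] := uk e i.
by exists (horner p) => //; exact: continuous_horner.
Qed.

Lemma pw_polyW k l u : (k <= l)%N -> pw_poly k u -> pw_poly l u.
Proof.
move=> kl uk e i; have [p sp up] := uk e i.
by exists p => //; exact: leq_trans kl.
Qed.

Lemma pw_poly_cst k (f : edge G -> R) : pw_poly k.+1 (fun e => cst (f e)).
Proof.
move=> e i; exists (f e)%:P => [|x _]; last by rewrite hornerC.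
exact: leq_trans (size_polyC_leq1 _) _.
Qed.

Lemma pw_polyD k u v : pw_poly k u -> pw_poly k v ->
  pw_poly k (fun e x => u e x + v e x).
Proof.
move=> uk vk e i; have [p sp up] := uk e i; have [q sq vq] := vk e i.
exists (p + q) => [|x xi]; last by rewrite hornerD up// vq.
by rewrite (leq_trans (size_polyD _ _))// geq_max sp.
Qed.

Lemma pw_polyZ k (c : R) u : pw_poly k u -> pw_poly k (fun e x => c * u e x).
Proof.
move=> uk e i; have [p sp up] := uk e i.
exists (c *: p) => [|x xi]; last by rewrite hornerZ up.
exact: leq_trans (size_scale_leq _ _) sp.
Qed.

Lemma pw_polyN k u : pw_poly k u -> pw_poly k (fun e x => - u e x).
Proof.
move=> uk e i; have [p sp up] := uk e i.
by exists (- p) => [|x xi]; [rewrite size_polyN|rewrite hornerN up].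
Qed.

Lemma pw_polyM k l u v : pw_poly k.+1 u -> pw_poly l.+1 v ->
  pw_poly (k + l).+1 (fun e x => u e x * v e x).
Proof.
move=> uk vl e i; have [p sp up] := uk e i; have [q sq vq] := vl e i.
exists (p * q) => [|x xi]; last by rewrite hornerM up// vq.
rewrite (leq_trans (size_polyMleq _ _))//.
(* The predecessor in the size bound truncates at 0, so vanishing sizes are split off. *)
by rewrite -ltnS; move: (size p) (size q) sp sq => [|m] [|n]; rewrite ?addn0 ?add0n//=; lia.
Qed.

(** A constant stays a constant under any map, without regularity of [phi]. This puts P'(rho) among
    the test functions and makes weights such as 1 / rho^2 piecewise constant. *)
Lemma pw_poly1_comp (phi : edge G -> R -> R) u :
  pw_poly 1 u -> pw_poly 1 (fun e x => phi e (u e x)).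
Proof.
move=> u1 e i; have [p sp up] := u1 e i.
exists (phi e p`_0)%:P => [|x xi]; first exact: size_polyC_leq1.
by rewrite up// hornerC {1}(size1_polyC sp) hornerC.
Qed.

(** The derivative is local and the element is open, so agreement near each point suffices. *)
Lemma dx_poly u e (i : 'I_(N e)) (p : {poly R}) :
  {in `]node e i, node e i.+1[, u e =1 horner p} ->
  {in `]node e i, node e i.+1[, dx u e =1 horner p^`()}.
Proof.
move=> up x xi; rewrite derivE /dx !derive1E; apply: near_eq_derive.
by near=> y; apply: up; near: y; exact: near_in_itvoo.
Unshelve. all: by end_near. Qed.

Lemma pw_poly_dx k u : pw_poly k.+1 u -> pw_poly k (dx u).
Proof.
move=> uk e i; have [p sp up] := uk e i.
exists p^`(); last exact: dx_poly.
by rewrite (leq_trans (size_poly _ _))//; case: (size p) sp.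
Qed.

Lemma pw_continuousD u v : pw_continuous u -> pw_continuous v ->
  pw_continuous (fun e x => u e x + v e x).
Proof.
move=> uc vc e i; have [f cf uf] := uc e i; have [g cg vg] := vc e i.
exists (fun x => f x + g x) => [x|x xi]; last by rewrite uf// vg.
by apply: cvgD; [exact: cf|exact: cg].
Qed.

Lemma pw_continuousM u v : pw_continuous u -> pw_continuous v ->
  pw_continuous (fun e x => u e x * v e x).
Proof.
move=> uc vc e i; have [f cf uf] := uc e i; have [g cg vg] := vc e i.
exists (fun x => f x * g x) => [x|x xi]; last by rewrite uf// vg.
by apply: cvgM; [exact: cf|exact: cg].
Qed.

Lemma pw_continuousN u : pw_continuous u -> pw_continuous (fun e x => - u e x).
Proof.
move=> uc e i; have [f cf uf] := uc e i.
by exists (fun x => - f x) => [x|x xi]; [apply: cvgN; exact: cf|rewrite uf].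
Qed.

Lemma pw_continuous_norm u : pw_continuous u -> pw_continuous (fun e x => `|u e x|).
Proof.
move=> uc e i; have [f cf uf] := uc e i.
by exists (fun x => `|f x|) => [x|x xi]; [apply: cvg_norm; exact: cf|rewrite uf].
Qed.

(** * Differentiation in time of integrals over the network *)

Lemma net_int_milne u : pw_poly 3 u ->
  net_int u = \sum_e \sum_(i < N e) milne (u e) (node e i) (node e i.+1).
Proof.
move=> u3; rewrite net_int_elements; last exact: pw_poly_continuous u3.
apply: eq_bigr => e _; apply: eq_bigr => i _; have [p sp up] := u3 e i.
exact: Rintegral_milne (mesh_node_lt _ _) up.
Qed.

(** Milne's rule makes both integrals the same finite linear combination of interior point values,
    so no limit has to be exchanged with an integral. *)
Lemma has_time_derivative_net_int T t (F : R -> netfun G) (dF : netfun G) :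
  t \in `[0, T] -> {in `[0, T], forall s, pw_poly 3 (F s)} -> pw_poly 3 dF ->
  (forall e (i : 'I_(N e)), {in `]node e i, node e i.+1[, forall x,
    has_time_derivative T (fun s => F s e x) t (dF e x)}) ->
  has_time_derivative T (fun s => net_int (F s)) t (net_int dF).
Proof.
move=> tT F3 dF3 FdF; rewrite net_int_milne//.
apply: (@eq_has_time_derivative _ _ _
  (fun s => \sum_e \sum_(i < N e) milne (F s e) (node e i) (node e i.+1))) => //.
  by move=> s sT; rewrite net_int_milne//; exact: F3.
apply: has_time_derivative_sum => e; apply: has_time_derivative_sum => i.
have ab := mesh_node_lt e i; have ae := FdF e i.
rewrite /milne; apply: has_time_derivativeZ; apply: has_time_derivativeD.
  apply: has_time_derivativeD; first apply: has_time_derivativeZ.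
    by apply: ae; rewrite in_itv/=; lra.
  rewrite -mulN1r; under eq_fun do rewrite -mulN1r.
  by apply: has_time_derivativeZ; apply: ae; rewrite in_itv/=; lra.
by apply: has_time_derivativeZ; apply: ae; rewrite in_itv/=; lra.
Qed.

(** The inverse inequality bounds the value by the integral over its own element; the other elements
    contribute nonnegative terms to the norm. *)
Lemma net_norm_ge_point w e (i : 'I_(N e)) x : pw_poly 2 w ->
  x \in `]node e i, node e i.+1[ ->
  `|w e x| <= Num.sqrt (6 / (node e i.+1 - node e i)) * net_norm w.
Proof.
move=> w2 xi; have [p sp wp] := w2 e i.
have ww : pw_continuous (fun e x => w e x * w e x).
  by apply: pw_continuousM; exact: pw_poly_continuous w2.
have ab := mesh_node_lt e i.
have h0 : 0 <= 6 / (node e i.+1 - node e i).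
  by rewrite divr_ge0// subr_ge0 ltW.
rewrite -sqrtr_sqr -sqrtrM//; apply: ler_wsqrtr.
apply: le_trans (inverse_inequality sp wp xi) _; apply: ler_wpM2l => //.
have elt_ge0 e' (j : 'I_(N e')) :
    0 <= \int[mu]_(y in `[node e' j, node e' j.+1]) (w e' y * w e' y).
  by apply: Rintegral_ge0 => y _; rewrite -expr2 sqr_ge0.
rewrite /net_ip net_int_elements// (bigD1 e)//= (bigD1 i)//=.
under eq_Rintegral do rewrite expr2.
by rewrite -addrA lerDl addr_ge0// !sumr_ge0// => e' _; rewrite sumr_ge0.
Qed.

Lemma C1_in_point T (X : netfun G -> Prop) (u du : R -> netfun G) t e
    (i : 'I_(N e)) x : (forall v, X v -> pw_poly 2 v) -> C1_in T X u du ->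
  t \in `[0, T] -> x \in `]node e i, node e i.+1[ ->
  has_time_derivative T (fun s => u s e x) t (du t e x).
Proof.
move=> X2 uC1 tT xi; have [/X2 ut2 /X2 dut2 udu _] := uC1 t tT.
rewrite /has_time_derivative -[du t e x]add0r.
(* The error of the difference quotient is again piecewise affine, so its norm controls its value at
   x. *)
pose w s := fun e x => (s - t)^-1 * (u s e x - u t e x) - du t e x.
suff wx : w s e x @[s --> within `[0, T] t^'] --> (0 : R).
  apply: cvg_trans (cvgD wx (cvg_cst (du t e x))).
  by apply: near_eq_cvg; apply: nearW => s; rewrite !fctE/= subrK.
set C := Num.sqrt (6 / (node e i.+1 - node e i)).
have {}udu : C * net_norm (w s) @[s --> within `[0, T] t^'] --> C * 0.
  by apply: cvgM udu; exact: cvg_cst.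
rewrite mulr0 in udu.
apply: norm_cvg0; apply: (squeeze_cvgr _ (cvg_cst 0) udu).
near=> s; rewrite normr_ge0/=; apply: net_norm_ge_point => //.
have sT : s \in `[0, T] by near: s; exact: withinT.
have [/X2 us2 _ _ _] := uC1 s sT.
apply: pw_polyD; last exact: pw_polyN.
by apply: pw_polyZ; apply: pw_polyD => //; exact: pw_polyN.
Unshelve. all: by end_near. Qed.

(** * Flux balance at the vertices and positivity on elements *)

Lemma mesh_node_ge0 e i : 0 <= node e i.
Proof. by rewrite /mesh_node divr_ge0 ?mulr_ge0// ltW// len_gt0. Qed.

Lemma mesh_node_le_len e (i : nat) : (i <= N e)%N -> node e i <= len e.
Proof.
move=> iN; rewrite -(mesh_nodeN e) /mesh_node ler_pM2r ?invr_gt0 ?ltr0n//.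
by rewrite ler_pM2l ?len_gt0// ler_nat.
Qed.

(** The polynomial supplies the derivative inside the element, while the continuity of u on the edge
    makes the boundary terms the values of u itself; hence they cancel between neighbouring
    elements. *)
Lemma Rintegral_dx k u e (i : 'I_(N e)) : pw_poly k u ->
  {within `[0, len e], continuous u e} ->
  \int[mu]_(x in `[node e i, node e i.+1]) dx u e x =
  u e (node e i.+1) - u e (node e i).
Proof.
move=> uk uc; have [p _ up] := uk e i; have ab := mesh_node_lt e i.
have dup := dx_poly up.
have {uc} [_ ua ub] : [/\ {in `]node e i, node e i.+1[, continuous (u e)},
    u e @ (node e i)^'+ --> u e (node e i) &
    u e @ (node e i.+1)^'- --> u e (node e i.+1)].
  apply/continuous_within_itvP => //; apply: continuous_subspaceW uc.
  move=> x /=; rewrite !in_itv/= => /andP[ix xi].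
  by rewrite (le_trans (mesh_node_ge0 _ _) ix) (le_trans xi)// mesh_node_le_len.
have cp : continuous (horner p^`()) by exact: continuous_horner.
rewrite (@eq_Rintegral_oo _ _ (horner p^`()))//.
- rewrite /Rintegral (@continuous_FTC2 _ _ (u e))//.
  + by apply: continuous_subspaceT => x; exact: cp.
  + split => // x xi.
    apply: (@near_eq_derivable _ _ _ (horner p)); last exact: derivable_horner.
    by near=> y; apply/esym/up; near: y; exact: near_in_itvoo.
- exact: integrable_agree_oo (ltW ab) dup.
- by apply: (@integrable_agree_oo _ _ (horner p^`())) => //; exact: ltW.
Unshelve. all: by end_near. Qed.

Lemma net_int_dx k u : pw_poly k.+1 u -> H0div u -> net_int (dx u) = 0.
Proof.
move=> uk [uH1 uv]; have uE e : \sum_(i < N e)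
    \int[mu]_(x in `[node e i, node e i.+1]) dx u e x = u e (len e) - u e 0.
  have [_ uc _] := uH1 e.
  under eq_bigr do rewrite (Rintegral_dx _ uk)//.
  rewrite -(big_mkord xpredT (fun i => u e (node e i.+1) - u e (node e i))).
  by rewrite telescope_sumr// mesh_node0 mesh_nodeN.
rewrite net_int_elements; last exact/pw_poly_continuous/pw_poly_dx/uk.
rewrite (eq_bigr _ (fun e _ => uE e)) sumrB.
(* The values at the ends of the edges are grouped by head, those at the beginnings by tail; the
   difference at each vertex is the flux balance of [H0div]. *)
rewrite (partition_big (@edge_head _ G) xpredT)//=.
rewrite [X in _ - X](partition_big (@edge_tail _ G) xpredT)//= -sumrB.
by rewrite big1.
Qed.

(** A nonpositive value at one point would be the value on the whole element, a set of positive
    measure. *)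
Lemma pw_poly1_gt0 u e (i : 'I_(N e)) : pw_poly 1 u ->
  net_ae (fun e x => 0 < u e x) -> {in `]node e i, node e i.+1[, forall x, 0 < u e x}.
Proof.
move=> u1 u_gt0 x xi; have [p sp up] := u1 e i; rewrite ltNge; apply/negP => ux.
have ab := mesh_node_lt e i.
have : mu.-negligible `]node e i, node e i.+1[.
  apply: negligibleS (u_gt0 e) => y /= yi; apply/not_implyP; split.
    have ilen := mesh_node_le_len (ltn_ord i).
    have i0 := mesh_node_ge0 e i.
    by move: yi; rewrite /edge_set/= !in_itv/=; lra.
  apply/negP; rewrite -leNgt (le_trans _ ux)// !up//.
  by rewrite (size1_polyC sp) !hornerC.
move=> /negligibleP -/(_ (measurable_itv _)).
move: (lebesgue_measure_itv `]node e i, node e i.+1[) => /= -> /=.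
rewrite lte_fin ab -EFinD => -[]/eqP.
by rewrite subr_eq0 gt_eqF.
Qed.

End PiecewisePolynomial.

(** * Time derivative of the energy density at a point *)

Section TimeDerivativeEnergy.
Context {R : realType}.

Lemma is_derive_pot (G : network R) (gam : R) (c : edge G -> R) e (r : R) :
  0 < r -> is_derive r (1 : R) (pot gam c e) (dpot gam c e r).
Proof.
move=> r_gt0; rewrite /dpot derive1E; apply: derivableP.
apply: derivableM; first exact: derivable_cst.
by apply: derivable_powR; rewrite in_itv/= andbT.
Qed.

(** The derivative is arranged as the left-hand side of the momentum equation times m, plus that of
    the mass equation times P'(rho). *)
Lemma has_time_derivative_energy (G : network R) (gam : R) (c : edge G -> R) e
    (T t : R) (m r : R -> R) (dm dr : R) :
  0 < r t -> has_time_derivative T m t dm -> has_time_derivative T r t dr ->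
  has_time_derivative T (fun s => m s ^+ 2 / (2 * r s) + pot gam c e (r s)) t
    (((r t)^-1 * dm - m t / (2 * r t ^+ 2) * dr) * m t
     + dr * dpot gam c e (r t)).
Proof.
move=> rt_gt0 mdm rdr.
have d2 : is_derive (r t) (1 : R) (fun x => 2 * x) 2.
  by apply: trigger_derive; rewrite /GRing.scale/= mulr1.
have r2_neq0 : 2 * r t != 0 by rewrite mulf_neq0 ?gt_eqF.
have dinv := is_deriveV r2_neq0 d2.
have := has_time_derivativeD
  (has_time_derivativeM (has_time_derivativeM mdm mdm)
    (has_time_derivative_comp dinv rdr))
  (has_time_derivative_comp (is_derive_pot gam c e rt_gt0) rdr).
congr has_time_derivative.
by rewrite /= /GRing.scale/=; field; lra.
Qed.

End TimeDerivativeEnergy.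

(** * Conservation of mass and the energy identity *)

Lemma pw_poly_L2 (R : realType) (G : network R) (N : edge G -> nat) k (u : netfun G) :
  (forall e, (0 < N e)%N) -> pw_poly N k u -> L2 u.
Proof.
move=> N_gt0 uk e; have uc := pw_poly_continuous uk.
have [/integrableP[/measurable_EFinP mu _] _] := pw_continuous_integrable N_gt0 e uc.
split => //; rewrite (_ : (fun x => _) = EFin \o (fun x => u e x * u e x))//.
by have [] := pw_continuous_integrable N_gt0 e (pw_continuousM uc uc).
Qed.

(** Adding the dissipation to the flux integrand of the momentum equation tested with m removes the
    a-term and leaves the remaining integrands of the two tested equations. Here P stands for
    P'(rho). *)
Lemma energy_balance (R : realFieldType) (m mx r P a b : R) :
  (m ^+ 2 / (2 * r ^+ 2) + P - a / r ^+ 2 * mx) * mx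
    + (a / r ^+ 2 * `|mx| ^+ 2 + b * (`|m| ^+ 3 / r ^+ 2)) =
  (m / (2 * r ^+ 2) * mx + b * (`|m| * m / r ^+ 2)) * m + mx * P.
Proof. by rewrite (exprS _ 2) !real_normK ?num_real//; ring. Qed.

Theorem lemma4p2 (R : realType) (G : network R)
    (a b c : edge G -> R) (gam : R) (N : edge G -> nat) (T : R)
    (rho0 m0 : netfun G) (rho m : R -> netfun G)
    (ha : forall e, 0 <= a e) (hb : forall e, 0 <= b e)
    (hc : forall e, 0 < c e) (hgam : 1 < gam)
    (hN : forall e, (0 < N e)%N) (hT : 0 < T)
    (hrho0 : Qh N rho0) (hrho0_gt0 : net_ae (fun e x => 0 < rho0 e x))
    (hm0 : Vh N m0)
    (hsol : semidiscrete_solution gam a b c N T rho0 m0 rho m) :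
  forall t, t \in `[0, T] ->
    has_time_derivative T (fun s => net_int (rho s)) t 0 /\
    exists2 D : R,
      has_time_derivative T
        (fun s => net_int (fun e x =>
           m s e x ^+ 2 / (2 * rho s e x) + pot gam c e (rho s e x))) t D &
      D + net_int (fun e x =>
           a e / rho t e x ^+ 2 * `|dx (m t) e x| ^+ 2
           + b e * (`|m t e x| ^+ 3 / rho t e x ^+ 2)) = 0.
Proof.
move=> t tT.
have [drho [dm [[rhoC1 mC1] rho_gt0 _ eqs]]] := hsol.
have [mass momentum] := eqs t tT.
have Q1 v : Qh N v -> pw_poly N 1 v by case.
have V2 v : Vh N v -> pw_poly N 2 v by case => -[].
have [/Q1 rho1 /Q1 drho1 _ _] := rhoC1 t tT.
have [mV /V2 dm2 _ _] := mC1 t tT.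
have m2 := V2 _ mV; have mx1 := pw_poly_dx m2.
have Qh_of v : pw_poly N 1 v -> Qh N v by move=> v1; split => //; exact: pw_poly_L2 v1.
have mc := pw_poly_continuous m2; have mxc := pw_poly_continuous mx1.
have rho_fc phi : pw_continuous N (fun e x => phi e (rho t e x)).
  exact: pw_poly_continuous (pw_poly1_comp _ rho1).
split.
  have -> : 0 = net_int (drho t).
    have net_ip1 (u : netfun G) : net_ip u (fun=> cst 1) = net_int u.
      by congr net_int; apply/funext => e; apply/funext => x; rewrite mulr1.
    have := mass _ (Qh_of _ (pw_poly_cst 0 (fun=> 1))).
    by rewrite !net_ip1 (net_int_dx hN m2) ?oppr0//; case: mV.
  apply: (has_time_derivative_net_int hN tT) => [s sT||e i x xi].
  - by have [/Q1 r1 _ _ _] := rhoC1 s sT; exact: pw_polyW r1.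
  - exact: pw_polyW drho1.
  - by apply: (C1_in_point hN _ rhoC1 tT xi) => v /Q1; exact: pw_polyW.
pose dE : netfun G := fun e x =>
  ((rho t e x)^-1 * dm t e x - m t e x / (2 * rho t e x ^+ 2) * drho t e x)
    * m t e x + drho t e x * dpot gam c e (rho t e x).
have pw1 phi : pw_poly N 1 (fun e x => phi e (rho t e x)).
  exact: pw_poly1_comp.
(* Powers of rho and [drho] have degree 0 on each element, [m] and [dm] degree 1; the product has
   degree at most 2, as the quadrature demands. *)
have kin3 : pw_poly N 3 (fun e x =>
  ((rho t e x)^-1 * dm t e x - m t e x / (2 * rho t e x ^+ 2) * drho t e x)
    * m t e x).
  apply: (pw_polyM (k := 1) (l := 1) _ m2); apply: pw_polyD.
    exact: (pw_polyM (k := 0) (l := 1) (pw1 (fun=> GRing.inv))).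
  apply: pw_polyN; apply: (pw_polyM (k := 1) (l := 0) _ drho1).
  exact: (pw_polyM (k := 1) (l := 0) m2 (pw1 (fun _ r => (2 * r ^+ 2)^-1))).
have pot1 : pw_poly N 1 (fun e x => drho t e x * dpot gam c e (rho t e x)).
  exact: (pw_polyM (k := 0) (l := 0) drho1 (pw1 (dpot gam c))).
exists (net_int dE).
  apply: (has_time_derivative_net_int hN tT) => [s sT||e i x xi].
  - have [/Q1 r1 _ _ _] := rhoC1 s sT; have [/V2 ms2 _ _ _] := mC1 s sT.
    apply: pw_polyD; last exact: pw_polyW (pw_poly1_comp (pot gam c) r1).
    exact: (pw_polyM (k := 2) (l := 0) (pw_polyM (k := 1) (l := 1) ms2 ms2)
      (pw_poly1_comp (fun _ r => (2 * r)^-1) r1)).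
  - by apply: pw_polyD => //; exact: pw_polyW pot1.
  - apply: has_time_derivative_energy.
    + exact: (pw_poly1_gt0 hN rho1 (rho_gt0 t tT)) xi.
    + exact: (C1_in_point hN V2 mC1 tT xi).
    + by apply: (C1_in_point hN _ rhoC1 tT xi) => v /Q1; exact: pw_polyW.
have kinc := pw_poly_continuous kin3; have potc := pw_poly_continuous pot1.
rewrite (net_intD hN kinc potc).
(* The mass equation is tested with P'(rho), then the momentum equation with m; all time derivatives
   disappear. *)
have := mass _ (Qh_of _ (pw1 (dpot gam c))); rewrite /net_ip/= => ->.
have := momentum _ mV; rewrite /net_ip/= => ->.
(* With B and C the two momentum integrands, D the dissipation and P the pressure term, it remains
   to show int B - int C - int P + int D = 0. Continuity of each justifies summing under the
   integral. *)
have Bc : pw_continuous N (fun e x =>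
  (m t e x ^+ 2 / (2 * rho t e x ^+ 2) + dpot gam c e (rho t e x)
   - a e / rho t e x ^+ 2 * dx (m t) e x) * dx (m t) e x).
  apply: (pw_continuousM _ mxc); apply: pw_continuousD.
    apply: (pw_continuousD _ (rho_fc (dpot gam c))).
    exact: (pw_continuousM (pw_continuousM mc mc)
      (rho_fc (fun _ r => (2 * r ^+ 2)^-1))).
  apply: pw_continuousN.
  exact: (pw_continuousM (rho_fc (fun e r => a e / r ^+ 2)) mxc).
have Cc : pw_continuous N (fun e x =>
  (m t e x / (2 * rho t e x ^+ 2) * dx (m t) e x
   + b e * (`|m t e x| * m t e x / rho t e x ^+ 2)) * m t e x).
  apply: (pw_continuousM _ mc); apply: pw_continuousD.
    apply: (pw_continuousM _ mxc).
    exact: (pw_continuousM mc (rho_fc (fun _ r => (2 * r ^+ 2)^-1))).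
  apply: (pw_continuousM (rho_fc (fun e _ => b e))).
  exact: (pw_continuousM (pw_continuousM (pw_continuous_norm mc) mc)
    (rho_fc (fun _ r => (r ^+ 2)^-1))).
have Dc : pw_continuous N (fun e x =>
  a e / rho t e x ^+ 2 * `|dx (m t) e x| ^+ 2
  + b e * (`|m t e x| ^+ 3 / rho t e x ^+ 2)).
  have nc := pw_continuous_norm mc; have nxc := pw_continuous_norm mxc.
  apply: pw_continuousD.
    exact: (pw_continuousM (rho_fc (fun e r => a e / r ^+ 2)) (pw_continuousM nxc nxc)).
  apply: (pw_continuousM (rho_fc (fun e _ => b e))).
  exact: (pw_continuousM (pw_continuousM nc (pw_continuousM nc nc))
    (rho_fc (fun _ r => (r ^+ 2)^-1))).
have Pc : pw_continuous N (fun e x => dx (m t) e x * dpot gam c e (rho t e x)).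
  exact: (pw_continuousM mxc (rho_fc (dpot gam c))).
have := net_intD hN Cc Pc; have := net_intD hN Bc Dc.
(* Pointwise B + D = C + P, so the two sums of integrals coincide. *)
under eq_fun do under eq_fun do rewrite energy_balance.
move=> -> balance.
by rewrite -[X in X + _]addrA -opprD addrAC balance subrr.
Qed.
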